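(* For all $p,\ell\in\mathbb{N}$, \[ \mu_{p,f}^\ell\,\mathrm{SSAC}(f)=\sum_{\mathfrak{P}\in\mathrm{Isom}(p)}|\mathfrak{P}|\;\mathrm{Sols}(\mathfrak{P},\ell). \]
   Context: $\mathbb{N}=\{0,1,2,\ldots\}$, $[n]=\{0,1,\ldots,n-1\}$ for $n\in\mathbb{N}$, and $S_n$ is the group of permutations of $[n]$. Sequences: a binary sequence of length $\ell$ is a doubly infinite list $f=(f_j)_{j\in\mathbb{Z}}$ with $f_j\in\{-1,1\}$ for $j\in[\ell]$ and $f_j=0$ otherwise; $\mathrm{Seq}(\ell)$ is the set of all $2^\ell$ of them with uniform probability measure. $C_f(s)=\sum_{j\in\mathbb{Z}}f_{j+s}\overline{f_j}$ for $s\in\mathbb{Z}$, and $\mathrm{SSAC}(f)=\sum_{s\in\mathbb{Z}}|C_f(s)|^2$. With $\mathbb{E}_f^\ell$ the expectation over $f\in\mathrm{Seq}(\ell)$, the $p$th central moment is $\mu_{p,f}^\ell v(f)=\mathbb{E}_f^\ell\big(v(f)-\mathbb{E}_f^\ell v(f)\big)^p$. Partitions: $\mathrm{Part}(p)$ is the set of partitions (into nonempty classes) of $[p]\times[2]\times[2]$. For $\mathcal{P}\in\mathrm{Part}(p)$, $\mathrm{As}(\mathcal{P},=)$ is the set of functions $\tau\colon[p]\times[2]\times[2]\to\mathbb{N}$ such that (a) $\tau_\beta=\tau_\gamma$ if and only if $\beta,\gamma$ lie in the same class of $\mathcal{P}$, and (b) $\tau_{e00}+\tau_{e01}=\tau_{e10}+\tau_{e11}$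 for every $e\in[p]$. $\mathrm{As}(\mathcal{P},=,\ell)$ is the set of $\tau\in\mathrm{As}(\mathcal{P},=)$ with all values in $[\ell]$. $\mathcal{P}$ is satisfiable if $\mathrm{As}(\mathcal{P},=)\ne\emptyset$. A partition is even if all of its classes have finite even cardinality. For $e\in[p]$, $\mathcal{P}_{\{e\}}=\{P\cap(\{e\}\times[2]\times[2]):P\in\mathcal{P}\}\smallsetminus\{\emptyset\}$. $\mathcal{P}$ is GELO if $\mathcal{P}$ is even but $\mathcal{P}_{\{e\}}$ is not even for every $e\in[p]$. $\mathrm{Con}(p)$ is the set of partitions in $\mathrm{Part}(p)$ that are both GELO and satisfiable. Isomorphism: $\mathcal{W}^{(p)}$ is the wreath product $(S_2\,\mathrm{Wr}_{[2]}\,S_2)\,\mathrm{Wr}_{[p]}\,S_p$, viewed as the group of all permutations $\pi$ of $[p]\times[2]\times[2]$ of the form $\pi(e,s,v)=\big(\epsilon(e),\sigma_{\epsilon(e)}(s),\phi_{\epsilon(e),\sigma_{\epsilon(e)}(s)}(v)\big)$ for some $\epsilon\in S_p$, $\sigma_e\in S_2$ ($e\in[p]$), $\phi_{e,s}\in S_2$ ($(e,s)\in[p]\times[2]$). It acts on partitions by $\pi(\mathcal{P})=\{\pi(P):P\in\mathcal{P}\}$. Partitions $\mathcal{P},\mathcal{Q}\in\mathrm{Part}(p)$ are isomorphic if $\mathcal{Q}=\pi(\mathcal{P})$ for some $\pi\in\mathcal{W}^{(p)}$. It is a fact that $\mathrm{Con}(p)$ is a union of isomorphism classes and that $|\mathrm{As}(\mathcal{P},=,\ell)|$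 is constant on each isomorphism class. $\mathrm{Isom}(p)$ is the set of isomorphism classes of partitions in $\mathrm{Con}(p)$, and for $\mathfrak{P}\in\mathrm{Isom}(p)$, $\mathrm{Sols}(\mathfrak{P},\ell)$ is the common value of $|\mathrm{As}(\mathcal{P},=,\ell)|$ for $\mathcal{P}\in\mathfrak{P}$. *)

(* Defs.v *)
From mathcomp Require Import all_boot all_order all_algebra all_fingroup finmap.
From mathcomp Require Import boolp classical_sets functions cardinality fsbigop.

Set Implicit Arguments.
Unset Strict Implicit.
Unset Printing Implicit Defensive.

Import Order.TTheory GRing.Theory Num.Theory.
Local Open Scope ring_scope.

Definition binSeq (C : numClosedFieldType) (l : nat) : set (int -> C) :=
  [set f | forall j : int,
     if (0 <= j) && (j < l%:Z) then f j = -1 \/ f j = 1 else f j = 0]%classic.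

(* [\sum_(j \in A) F j] is [0] by convention when [F] has infinite support on
   [A]; this never happens for a binary sequence [f], in [autocorr] or [ssac]. *)
Definition autocorr (C : numClosedFieldType) (f : int -> C) (s : int) : C :=
  \sum_(j \in [set: int]%classic) f (j + s) * (f j)^*.

Definition ssac (C : numClosedFieldType) (f : int -> C) : C :=
  \sum_(s \in [set: int]%classic) `|autocorr f s| ^+ 2.

Definition expect (C : numClosedFieldType) (l : nat) (v : (int -> C) -> C) : C :=
  (\sum_(f \in @binSeq C l) v f) / #|` fset_set (@binSeq C l)|%:R.

Definition central_moment (C : numClosedFieldType) (p l : nat)
    (v : (int -> C) -> C) : C :=
  expect l (fun f => (v f - expect l v) ^+ p).

Definition idx (p : nat) : finType := ('I_p * 'I_2 * 'I_2)%type.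

Definition Part (p : nat) : {set {set {set idx p}}} :=
  [set P | finset.partition P [set: idx p]]%SET.

Definition assignments (p : nat) (P : {set {set idx p}}) : set (idx p -> nat) :=
  [set tau |
     (forall b c : idx p,
        tau b = tau c <-> exists2 A, A \in P & b \in A /\ c \in A) /\
     (forall e : 'I_p,
        (tau (e, 0%R, 0%R) + tau (e, 0%R, 1%R))%N = (tau (e, 1%R, 0%R) + tau (e, 1%R, 1%R))%N)]%classic.

Definition assignments_lt (p : nat) (P : {set {set idx p}}) (l : nat) :
    set (idx p -> nat) :=
  [set tau | assignments P tau /\ forall b, (tau b < l)%N]%classic.

Definition satisfiable (p : nat) (P : {set {set idx p}}) : Prop :=
  (assignments P !=set0)%classic.

Definition even_part (p : nat) (P : {set {set idx p}}) : bool :=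
  [forall A in P, ~~ odd #|A|].

Definition restr (p : nat) (P : {set {set idx p}}) (e : 'I_p) :
    {set {set idx p}} :=
  ([set A :&: [set b : idx p | b.1.1 == e] | A in P] :\ finset.set0)%SET.

Definition gelo (p : nat) (P : {set {set idx p}}) : bool :=
  even_part P && [forall e : 'I_p, ~~ even_part (restr P e)].

Definition Con (p : nat) : {set {set {set idx p}}} :=
  [set P in Part p | gelo P && `[< satisfiable P >]]%SET.

Definition wreath (p : nat) : {set {perm idx p}} :=
  [set pi : {perm idx p} |
    [exists eps : 'S_p, exists sigma : {ffun 'I_p -> 'S_2},
     exists phi : {ffun 'I_p * 'I_2 -> 'S_2},
     forall e : 'I_p, forall s : 'I_2, forall v : 'I_2,
       pi (e, s, v) ==
         (eps e, sigma (eps e) s, phi (eps e, sigma (eps e) s) v)]]%SET.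

Definition part_act (p : nat) (pi : {perm idx p}) (P : {set {set idx p}}) :
    {set {set idx p}} :=
  [set [set pi b | b in A] | A : {set idx p} in P]%SET.

Definition isomorphic (p : nat) (P Q : {set {set idx p}}) : bool :=
  [exists pi in wreath p, Q == part_act pi P].

Definition iso_class (p : nat) (P : {set {set idx p}}) : {set {set {set idx p}}} :=
  [set Q in Part p | isomorphic P Q]%SET.

Definition Isom (p : nat) : {set {set {set {set idx p}}}} :=
  [set iso_class P | P in Con p]%SET.

(* [#|As(P, =, l)|] is constant on isomorphism classes, so the representative
   [P] selected from the class [PP] is immaterial; [0] is a dummy value for the
   empty set, which is not an isomorphism class. *)
Definition Sols (p : nat) (PP : {set {set {set idx p}}}) (l : nat) : nat :=
  if [pick P in PP] is Some P then #|` fset_set (assignments_lt P l)| else 0.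

(* Main.v *)
(* Expanding the squares, SSAC(f) is the sum, over the quadruples of indices with
   [q00 + q01 = q10 + q11], of the products of the four corresponding terms of [f].
   Over random signs, the mean of a product of terms of [f] is [1] if every index
   occurs an even number of times and [0] otherwise.  Subtracting the mean of SSAC
   therefore deletes the quadruples with even multiplicities, and the [p]th moment
   of what remains counts the [tau : [p] x [2] x [2] -> [l]] with balanced blocks,
   globally even multiplicities, and no block with even multiplicities.  The
   partition into fibers of [tau] is in [Con p] exactly under these parity
   conditions, so the moment is the sum of [#|As(P, =, l)|] over [P] in [Con p],
   which is then grouped by isomorphism classes. *)
Require Import Defs.
From mathcomp Require Import all_boot all_order all_algebra all_fingroup finmap.
From mathcomp Require Import boolp classical_sets functions cardinality fsbigop.

Set Implicit Arguments.
Unset Strict Implicit.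
Unset Printing Implicit Defensive.

Import Order.TTheory GRing.Theory Num.Theory.
Local Open Scope ring_scope.

(** * Binary sequences as sign vectors, and averages over them *)

Lemma big_uniq_pred1 (V : nmodType) (I : eqType) (r : seq I) (x : I) (F : I -> V) :
  uniq r -> x \in r -> \sum_(i <- r | i == x) F i = F x.
Proof.
move=> ur xr; rewrite big_mkcond (bigD1_seq x) //= eqxx big1 ?addr0 // => i.
by move/negbTE->.
Qed.

(** The sum has at most one term; when empty it supplies the value 0 outside [[0, l)], without
    converting [j] to an ordinal. *)
Definition sgnSeq (C : numClosedFieldType) (l : nat) (eps : {ffun 'I_l -> bool})
    (j : int) : C :=
  \sum_(i < l | j == i%:Z) (-1) ^+ eps i.

Lemma sgnSeqE (C : numClosedFieldType) (l : nat) (eps : {ffun 'I_l -> bool}) (i : 'I_l) :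
  sgnSeq C eps i%:Z = (-1) ^+ eps i.
Proof. by rewrite /sgnSeq (big_pred1 i) // => j; rewrite eq_sym. Qed.

Lemma sgnSeq0 (C : numClosedFieldType) (l : nat) (eps : {ffun 'I_l -> bool}) (j : int) :
  ~~ ((0 <= j) && (j < l%:Z)) -> sgnSeq C eps j = 0.
Proof.
move=> jP; rewrite /sgnSeq big1 // => i /eqP ji.
by case/negP: jP; rewrite ji /= ltz_nat ltn_ord.
Qed.

Lemma sgnSeq_inj (C : numClosedFieldType) (l : nat) : injective (@sgnSeq C l).
Proof.
move=> e1 e2 e12; apply/ffunP => i; have := congr1 (fun f => f i%:Z) e12.
rewrite !sgnSeqE; case: (e1 i) (e2 i) => [] [] //= /eqP; last rewrite eq_sym.
all: by rewrite expr0 expr1 eq_sym -subr_eq0 opprK (pnatr_eq0 _ 2).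
Qed.

Lemma binSeq_range (C : numClosedFieldType) (l : nat) :
  @binSeq C l = (@sgnSeq C l @` setT)%classic.
Proof.
apply/seteqP; split=> [f fP|_ [eps _ <-] j] /=; last first.
  have [/andP[j0 jl]|jn] := boolP (_ && _); last exact: sgnSeq0.
  case: j j0 jl => // n _; rewrite ltz_nat => nl.
  rewrite (sgnSeqE _ eps (Ordinal nl)).
  by case: (eps _); [left|right].
exists [ffun i : 'I_l => f i%:Z == -1] => //; apply/funext => j.
have := fP j; case: ifP => [/andP[j0 jl]|/negbT jn ->]; last exact: sgnSeq0.
case: j j0 jl => // n _; rewrite ltz_nat => nl fn.
rewrite (sgnSeqE _ _ (Ordinal nl)) ffunE /=.
by case: eqP fn => [->|nf [/nf[]|->]].
Qed.

Lemma fsbig_image_finset (V : nmodType) (T : finType) (J : choiceType) (h : T -> J)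
    (A : {set T}) (F : J -> V) : injective h ->
  \sum_(j \in (h @` [set` A])%classic) F j = \sum_(t in A) F (h t).
Proof.
move=> h_inj; rewrite fsbig_image; last by move=> x y _ _; apply: h_inj.
rewrite -[RHS]big_enum [RHS]fsbig_seq ?enum_uniq //.
rewrite (_ : [set` enum _]%classic = [set` A]%classic) //.
by apply/seteqP; split=> x /=; rewrite mem_enum.
Qed.

Lemma card_fset_set_image (T : finType) (J : choiceType) (h : T -> J) (A : {set T}) :
  injective h -> #|` fset_set (h @` [set` A])%classic| = #|A|.
Proof.
move=> h_inj; rewrite card_fset_sum1 -fsbig_finite; last first.
  by apply: finite_image; apply: finite_finset.
by rewrite fsbig_image_finset // sum1_card.
Qed.

Lemma expectE (C : numClosedFieldType) (l : nat) (v : (int -> C) -> C) :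
  expect l v = (\sum_(eps : {ffun 'I_l -> bool}) v (sgnSeq C eps)) / (2 ^ l)%:R.
Proof.
rewrite /expect; have -> :
    @binSeq C l = (@sgnSeq C l @` [set` [set: {ffun 'I_l -> bool}]%SET])%classic.
  by rewrite binSeq_range; congr image; apply/seteqP; split=> x //= _; rewrite inE.
rewrite fsbig_image_finset; last exact: sgnSeq_inj.
rewrite card_fset_set_image; last exact: sgnSeq_inj.
rewrite cardsT card_ffun card_bool card_ord; congr (_ / _).
by apply: eq_bigl => x; rewrite inE.
Qed.

(** * SSAC as a sum over balanced quadruples *)

Lemma autocorr_sgnSeq (C : numClosedFieldType) (l : nat) (eps : {ffun 'I_l -> bool}) (s : int) :
  autocorr (sgnSeq C eps) s =
  \sum_(x : 'I_l * 'I_l | s == x.2%:Z - x.1%:Z) (-1) ^+ eps x.1 * (-1) ^+ eps x.2.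
Proof.
pose r := [seq (nat_of_ord i)%:Z | i <- enum 'I_l].
have ur : uniq r.
  by rewrite map_inj_uniq ?enum_uniq // => i j [] /val_inj.
(* The conjugated factor vanishes off [r], so [r] contains the support. *)
rewrite /autocorr (fsbigE r) //; last first.
  move=> j _ jr; rewrite [X in _ * X^*]/sgnSeq big1 ?conjC0 ?mulr0 // => i /eqP ji.
  by case/negP: jr; rewrite ji map_f ?mem_enum.
under eq_bigl do rewrite in_setT.
rewrite big_map big_enum -(pair_big_dep xpredT (fun i j : 'I_l => s == j%:Z - i%:Z)
  (fun i j => (-1) ^+ eps i * (-1) ^+ eps j)) /=.
apply: eq_bigr => i _; rewrite sgnSeqE rmorph_sign mulrC -mulr_sumr; congr (_ * _).
by apply: eq_bigl => j; rewrite eq_sym [RHS]eq_sym subr_eq addrC.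
Qed.

Definition balanced (l : nat) (q : 'I_2 * 'I_2 -> 'I_l) : bool :=
  (q (0%R, 0%R) + q (0%R, 1%R) == q (1%R, 0%R) + q (1%R, 1%R))%N.

(** The square at shift [s] runs over two pairs of indices, both of difference [s]; summing over [s]
    leaves the pairs of pairs with equal differences. *)
Lemma ssac_sgnSeq (C : numClosedFieldType) (l : nat) (eps : {ffun 'I_l -> bool}) :
  ssac (sgnSeq C eps) =
  \sum_(q : {ffun 'I_2 * 'I_2 -> 'I_l} | balanced q) \prod_t (-1) ^+ eps (q t).
Proof.
pose d (x : 'I_l * 'I_l) : int := x.2%:Z - x.1%:Z.
pose w (x : 'I_l * 'I_l) : C := (-1) ^+ eps x.1 * (-1) ^+ eps x.2.
pose r := undup [seq d x | x <- enum {: 'I_l * 'I_l}].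
have rP x : d x \in r by rewrite mem_undup map_f ?mem_enum.
have ur : uniq r by rewrite undup_uniq.
have sqE s : `|autocorr (sgnSeq C eps) s| ^+ 2 =
    \sum_(x | s == d x) \sum_(y | s == d y) w x * w y.
  (* A sum of products of signs is real, so its squared modulus is its square. *)
  rewrite autocorr_sgnSeq real_normK; last first.
    by apply: rpred_sum => x _; apply: rpredM; apply: rpredX; rewrite realN real1.
  by rewrite expr2 mulr_suml; apply: eq_bigr => x _; rewrite mulr_sumr.
rewrite /ssac (fsbigE r) //; last first.
  move=> s _ sr; rewrite sqE big1 // => x /eqP sx.
  by case/negP: sr; rewrite sx.
under eq_bigl do rewrite in_setT.
under eq_bigr do rewrite sqE.
rewrite (exchange_big_dep xpredT) //=.
under eq_bigr do rewrite (big_uniq_pred1 _ ur (rP _)).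
rewrite (pair_big_dep xpredT (fun x y => d x == d y) (fun x y => w x * w y)) /=.
(* Chosen so that equality of differences, [q00 - q11 = q10 - q01], rearranges to the balance
   condition. *)
pose h (q : {ffun 'I_2 * 'I_2 -> 'I_l}) : ('I_l * 'I_l) * ('I_l * 'I_l) :=
  ((q (1, 1), q (0, 0)), (q (0, 1), q (1, 0))).
pose g (z : ('I_l * 'I_l) * ('I_l * 'I_l)) : {ffun 'I_2 * 'I_2 -> 'I_l} :=
  [ffun t => if t.1 == 0 then if t.2 == 0 then z.1.2 else z.2.1
             else if t.2 == 0 then z.2.2 else z.1.1].
have I2 (i : 'I_2) : i = if i == 0 then 0 else 1.
  by apply/val_inj; case: i => [[|[|]]].
have hg : cancel g h.
  by move=> [[x1 x2] [y1 y2]]; rewrite /h /g !ffunE.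
have gh : cancel h g.
  move=> q; apply/ffunP => -[i j]; rewrite /g /h ffunE /= (I2 i) (I2 j).
  by case: (i == 0); case: (j == 0).
rewrite (reindex h) /=; last by exists g => ? _; [apply: gh|apply: hg].
apply: eq_big => [q|q _]; rewrite /d /w /balanced /=.
  rewrite subr_eq addrAC eq_sym subr_eq -!PoszD eqz_nat eq_sym.
  by congr (_ == _).
rewrite [RHS](eq_bigr (fun t => (-1) ^+ eps (q (t.1, t.2)))); last by case.
rewrite -(pair_bigA _ (fun i j => (-1) ^+ eps (q (i, j)))) /=.
rewrite !big_ord_recl !big_ord0 !mulr1 /=.
have -> : lift ord0 ord0 = 1 :> 'I_2 by apply/val_inj.
have -> : ord0 = 0 :> 'I_2 by apply/val_inj.
by rewrite [LHS](AC (2*2) ((2*3)*(4*1))) /=.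
Qed.

(** * Averages of sign products and the central moment *)

Definition even_fibers (T : finType) (l : nat) (g : T -> 'I_l) : bool :=
  [forall v, ~~ odd #|[set t | g t == v]|].

(** With [m_v] the multiplicity of the value [v], the sum factors as the product over [v] of
    [1 + (-1)^m_v], and each factor is 2 or 0 according to the parity of [m_v]. *)
Lemma sum_sign_prod (R : comNzRingType) (T : finType) (l : nat) (g : T -> 'I_l) :
  \sum_(eps : {ffun 'I_l -> bool}) \prod_t (-1) ^+ eps (g t) =
  (even_fibers g)%:R * (2 ^ l)%:R :> R.
Proof.
transitivity (\sum_(eps : {ffun 'I_l -> bool})
   \prod_v (-1) ^+ (eps v * #|[set t | g t == v]|) : R).
  apply: eq_bigr => eps _; rewrite (partition_big g xpredT) //=.
  apply: eq_bigr => v _; rewrite exprM -prodr_const.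
  rewrite [RHS](eq_bigl (fun t => g t == v)) => [|t]; last by rewrite inE.
  by apply: eq_bigr => t /eqP->.
rewrite -(bigA_distr_bigA (fun v (b : bool) => (-1) ^+ (b * #|[set t | g t == v]|))).
under eq_bigr do rewrite big_bool mul1n mul0n expr0 -signr_odd.
have [/forallP ev|/forallPn[v]] := boolP (even_fibers g).
  rewrite mul1r (eq_bigr (fun=> 2)); first by rewrite prodr_const card_ord natrX.
  by move=> v _; rewrite (negbTE (ev v)) expr0.
by rewrite negbK => ov; rewrite (bigD1 v) //= ov expr1 addNr !mul0r.
Qed.

Definition block_fun (p l : nat) (tau : {ffun idx p -> 'I_l}) (e : 'I_p)
    (t : 'I_2 * 'I_2) : 'I_l := tau (e, t.1, t.2).

(** The terms that survive in the moment: balance comes from SSAC, global evenness from averaging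
    over signs, and non-evenness of each block from centering. *)
Definition good (p l : nat) (tau : {ffun idx p -> 'I_l}) : bool :=
  [&& [forall e, balanced (block_fun tau e)], even_fibers tau
    & [forall e, ~~ even_fibers (block_fun tau e)]].

Lemma expect_ssac (C : numClosedFieldType) (l : nat) :
  expect l (@ssac C) =
  \sum_(q : {ffun 'I_2 * 'I_2 -> 'I_l} | balanced q) (even_fibers q)%:R.
Proof.
rewrite expectE; under eq_bigr do rewrite ssac_sgnSeq.
rewrite exchange_big mulr_suml; apply: eq_bigr => q _ /=.
by rewrite sum_sign_prod mulfK // pnatr_eq0 expn_eq0.
Qed.

(* The mean removes exactly the terms [q] of [ssac_sgnSeq] with even fibers, as
   these are the terms whose product of signs is identically [1]. *)
Lemma ssac_centered (C : numClosedFieldType) (l : nat) (eps : {ffun 'I_l -> bool}) :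
  ssac (sgnSeq C eps) - expect l (@ssac C) =
  \sum_(q : {ffun 'I_2 * 'I_2 -> 'I_l})
    (balanced q && ~~ even_fibers q)%:R * \prod_t (-1) ^+ eps (q t).
Proof.
rewrite ssac_sgnSeq expect_ssac -sumrB big_mkcond; apply: eq_bigr => q _.
case: ifP => _; last by rewrite mul0r.
have [ev|_] := boolP (even_fibers q); last by rewrite subr0 mul1r.
rewrite mul0r (partition_big q xpredT) //= big1 ?subrr // => v _.
rewrite (eq_bigr (fun=> (-1) ^+ eps v)) => [|t /eqP-> //].
rewrite (eq_bigl (fun t => t \in [set t | q t == v])) => [|t]; last by rewrite inE.
by rewrite prodr_const exprAC -signr_odd (negbTE (forallP ev v)) expr1n.
Qed.

Lemma central_moment_good (C : numClosedFieldType) (p l : nat) :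
  central_moment p l (@ssac C) = #|[set tau : {ffun idx p -> 'I_l} | good tau]|%:R.
Proof.
rewrite /central_moment expectE.
pose K (q : {ffun 'I_2 * 'I_2 -> 'I_l}) : C := (balanced q && ~~ even_fibers q)%:R.
(* Currying: a [p]-tuple of quadruples is the same as one function on [idx p]. *)
pose h (tau : {ffun idx p -> 'I_l}) : {ffun 'I_p -> {ffun 'I_2 * 'I_2 -> 'I_l}} :=
  [ffun e => finfun (block_fun tau e)].
pose g (F : {ffun 'I_p -> {ffun 'I_2 * 'I_2 -> 'I_l}}) : {ffun idx p -> 'I_l} :=
  [ffun b => F b.1.1 (b.1.2, b.2)].
have bij_h : bijective h.
  exists g => [tau|F].
    by apply/ffunP => -[[e s] v]; rewrite !ffunE.
  by apply/ffunP => e; apply/ffunP => -[s v]; rewrite !ffunE /block_fun /g ffunE.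
transitivity ((\sum_(eps : {ffun 'I_l -> bool}) \sum_(tau : {ffun idx p -> 'I_l})
  (\prod_e K (finfun (block_fun tau e))) * \prod_b (-1) ^+ eps (tau b)) / (2 ^ l)%:R).
  congr (_ / _); apply: eq_bigr => eps _.
  (* The power becomes a product over blocks, which then distributes over the sum. *)
  rewrite -[X in _ ^+ X](card_ord p) -prodr_const.
  under eq_bigr do rewrite ssac_centered.
  rewrite bigA_distr_bigA (reindex h) /=; last exact: onW_bij.
  apply: eq_bigr => tau _; rewrite big_split /=; congr (_ * _).
    by apply: eq_bigr => e _; rewrite !ffunE.
  rewrite pair_bigA /=.
  rewrite (reindex (fun b : idx p => (b.1.1, (b.1.2, b.2)))) /=.
    by apply: eq_bigr => -[[e s] v] _; rewrite !ffunE.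
  by apply: onW_bij; exists (fun b => (b.1, b.2.1, b.2.2)) => [[[]]|[? []]].
rewrite exchange_big /= mulr_suml -sum1dep_card natr_sum [RHS]big_mkcond /=.
apply: eq_bigr => tau _; rewrite -mulr_sumr sum_sign_prod mulrA mulfK; last first.
  by rewrite pnatr_eq0 expn_eq0.
have evE e : even_fibers (finfun (block_fun tau e)) = even_fibers (block_fun tau e).
  by apply: eq_forallb => v; congr (~~ odd _); apply: eq_card => t; rewrite !inE ffunE.
have balE e : balanced (finfun (block_fun tau e)) = balanced (block_fun tau e).
  by rewrite /balanced !ffunE.
rewrite -natr_prod -natrM /good.
(* The product of indicators must match the conjunction in [good]; any failing block contributes a
   factor 0. *)
have [/forallP bal|/forallPn[e be]] :=
  boolP [forall e, balanced (block_fun tau e)]; last first.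
  by rewrite (bigD1 e) //= balE (negbTE be) !mul0n.
have [_|_] := boolP (even_fibers tau); last by rewrite muln0.
have [/forallP oddb|/forallPn[e be]] :=
  boolP [forall e, ~~ even_fibers (block_fun tau e)]; last first.
  by rewrite (bigD1 e) //= evE (negbNE be) andbF !mul0n.
rewrite big1 ?muln1 // => e _; by rewrite evE balE bal oddb.
Qed.

(** * Partitions into fibers and the set [Con p] *)

Lemma preim_partition_sameP (T : finType) (U : eqType) (f : T -> U) (b c : T) :
  f b = f c <->
  exists2 A, A \in preim_partition f [set: T]%SET & b \in A /\ c \in A.
Proof.
split=> [fbc|[_ /imsetP[x _ ->]]]; last by rewrite !inE /= => -[/eqP<- /eqP<-].
exists [set y in [set: T]%SET | f b == f y]%SET; last by rewrite !inE /= fbc eqxx.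
by apply/imsetP; exists b.
Qed.

(** A block containing [x] is the fiber through [x]: a point with the same value shares some block
    with [x], and disjointness makes it the given one. Covering shows that every fiber arises. *)
Lemma partition_same_eq (T : finType) (U : eqType) (f : T -> U) (P : {set {set T}}) :
  finset.partition P [set: T]%SET ->
  (forall b c, f b = f c <-> exists2 A, A \in P & b \in A /\ c \in A) ->
  P = preim_partition f [set: T]%SET.
Proof.
move=> partP sameP; have tiP := partition_trivIset partP.
have blockE A x : A \in P -> x \in A -> A = [set y in [set: T]%SET | f x == f y]%SET.
  move=> AP xA; apply/finset.setP => y; rewrite !inE /=.
  apply/idP/eqP => [yA|/sameP[B BP [xB yB]]]; first by apply/sameP; exists A.
  by rewrite -(def_pblock tiP AP xA) (def_pblock tiP BP xB).
apply/finset.setP => A; apply/idP/imsetP => [AP|[x _ ->]].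
  have /set0Pn[x xA] : A != finset.set0 := partition_neq0 partP AP.
  by exists x; rewrite ?inE //; apply: blockE.
have : x \in finset.cover P by rewrite (cover_partition partP) inE.
by case/finset.bigcupP => B BP xB; rewrite -(blockE B).
Qed.

(** Used with [D] the whole index set for global evenness and with [D] one block for restrictions.
    Values not attained have empty, hence even, fibers. *)
Lemma even_preim_partition (T : finType) (l : nat) (f : T -> 'I_l) (D : {set T}) :
  [forall A in preim_partition f [set: T]%SET, ~~ odd #|(A :&: D)%SET|] =
  [forall v, ~~ odd #|[set t in D | f t == v]%SET|].
Proof.
have fibE x : ([set y in [set: T] | f x == f y] :&: D = [set t in D | f t == f x])%SET.
  by apply/finset.setP => t; rewrite !inE /= andbC eq_sym.
apply/forall_inP/forallP => [ev v|ev _ /imsetP[x _ ->]]; last by rewrite fibE.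
have [x /eqP <-|noV] := pickP (fun x => f x == v).
  by rewrite -fibE ev //; apply: imset_f.
rewrite (_ : [set t in D | _]%SET = finset.set0) ?cards0 //.
by apply/finset.setP => t; rewrite !inE noV andbF.
Qed.

Definition idx_block (p : nat) (e : 'I_p) : {set idx p} := [set b | b.1.1 == e]%SET.

(** The empty intersections discarded by [restr] have even cardinality, so keeping them changes
    nothing. *)
Lemma even_restr (p : nat) (P : {set {set idx p}}) (e : 'I_p) :
  even_part (restr P e) = [forall A in P, ~~ odd #|(A :&: idx_block e)%SET|].
Proof.
apply/forall_inP/forall_inP => ev A.
  move=> AP; have [->|A0] := eqVneq (A :&: idx_block e)%SET finset.set0.
    by rewrite cards0.
  by apply: ev; rewrite !inE A0; apply: imset_f.
by rewrite !inE => /andP[_ /imsetP[B BP ->]]; apply: ev.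
Qed.

Lemma gelo_preim_partition (p l : nat) (tau : {ffun idx p -> 'I_l}) :
  gelo (preim_partition tau [set: idx p]%SET) =
  even_fibers tau && [forall e, ~~ even_fibers (block_fun tau e)].
Proof.
rewrite /gelo; congr andb.
  transitivity [forall A in preim_partition tau [set: idx p]%SET,
      ~~ odd #|(A :&: [set: idx p])%SET|].
    by apply: eq_forallb => A; rewrite finset.setIT.
  rewrite even_preim_partition; apply: eq_forallb => v; congr (~~ odd _).
  by apply: eq_card => t; rewrite !inE.
apply: eq_forallb => e; congr negb; rewrite even_restr even_preim_partition.
apply: eq_forallb => v; congr (~~ odd _).
(* Fibers of [block_fun tau e] are embedded into [idx p] to be compared with fibers of [tau] inside
   the block. *)
rewrite -(card_imset _ (f := fun t : 'I_2 * 'I_2 => (e, t.1, t.2))); last first.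
  by move=> [? ?] [? ?] [-> ->].
apply: eq_card => -[[e' s] w]; rewrite !inE /=; apply/andP/imsetP.
  by case=> /eqP-> tv; exists (s, w); rewrite ?inE.
by case=> -[s' w']; rewrite inE /block_fun /= => tv [-> -> ->].
Qed.

(** A finite-type copy of [assignments_lt], over which sums can be exchanged. *)
Definition asgn (p : nat) (P : {set {set idx p}}) (l : nat) : {set {ffun idx p -> 'I_l}} :=
  [set tau : {ffun idx p -> 'I_l} | `[< assignments P (fun b => tau b : nat) >]]%SET.

Lemma card_assignments_lt (p : nat) (P : {set {set idx p}}) (l : nat) :
  #|` fset_set (assignments_lt P l)| = #|asgn P l|.
Proof.
pose h (tau : {ffun idx p -> 'I_l}) (b : idx p) : nat := tau b.
have h_inj : injective h.
  by move=> s t st; apply/ffunP => b; apply/val_inj; apply: (congr1 (fun f => f b) st).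
rewrite -(card_fset_set_image _ h_inj); congr (#|` fset_set _|).
apply/seteqP; split=> [tau [tauP tau_lt]|_ [tau + <-]] /=; last first.
  by rewrite /= inE => /asboolP tauP; split=> // b; apply: ltn_ord.
exists [ffun b => Ordinal (tau_lt b)].
  rewrite /= inE; apply/asboolP; congr assignments: tauP.
  by apply/funext => b; rewrite ffunE.
by apply/funext => b; rewrite /h ffunE.
Qed.

Lemma mem_asgn (p l : nat) (P : {set {set idx p}}) (tau : {ffun idx p -> 'I_l}) :
  P \in Part p ->
  (tau \in asgn P l) =
  [forall e, balanced (block_fun tau e)] && (P == preim_partition tau [set: idx p]%SET).
Proof.
rewrite inE => partP; rewrite inE; apply/asboolP/andP => [[same bal]|[/forallP bal /eqP->]].
  split; first by apply/forallP => e; apply/eqP; apply: bal.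
  apply/eqP; apply: partition_same_eq => // b c; rewrite -same.
  by split=> [->|/val_inj].
split=> [b c|e]; last exact/eqP/bal.
by rewrite -preim_partition_sameP; split=> [/val_inj|->].
Qed.

(** Double counting of pairs [(P, tau)]: a good [tau] is an assignment for exactly one [P] in
    [Con p], its partition into fibers. *)
Lemma sum_asgn_Con (p l : nat) :
  (\sum_(P in Con p) #|asgn P l|)%N = #|[set tau : {ffun idx p -> 'I_l} | good tau]%SET|.
Proof.
transitivity (\sum_(P in Con p) \sum_(tau in asgn P l) 1)%N.
  by apply: eq_bigr => P _; rewrite sum1_card.
rewrite (exchange_big_dep (fun tau : {ffun idx p -> 'I_l} => good tau)) /=; last first.
  move=> P tau; rewrite inE => /andP[Pp /andP[gP _]]; rewrite mem_asgn // /good.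
  by case/andP=> -> /eqP PE; rewrite -gelo_preim_partition -PE.
rewrite -sum1dep_card; apply: eq_bigr => tau.
rewrite /good -gelo_preim_partition => /andP[bal gel].
have kP : preim_partition tau [set: idx p]%SET \in Part p by rewrite inE preim_partitionP.
rewrite (big_pred1 (preim_partition tau [set: idx p]%SET)) // => P.
apply/andP/eqP => [[]|->].
  by rewrite inE => /andP[Pp _]; rewrite mem_asgn // => /andP[_ /eqP].
have tauA : tau \in asgn (preim_partition tau [set: idx p]%SET) l.
  by rewrite mem_asgn // bal eqxx.
split=> //; rewrite inE kP gel; apply/asboolP.
(* Satisfiability is witnessed by [tau] itself. *)
by exists (fun b => tau b : nat); move: tauA; rewrite inE => /asboolP.
Qed.

(** * The wreath product as a group, and isomorphism as an equivalence *)

Lemma wreathP (p : nat) (pi : {perm idx p}) :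
  reflect (exists (eps : 'S_p) (sigma : {ffun 'I_p -> 'S_2})
                  (phi : {ffun 'I_p * 'I_2 -> 'S_2}),
             forall e s v,
               pi (e, s, v) = (eps e, sigma (eps e) s, phi (eps e, sigma (eps e) s) v))
          (pi \in wreath p).
Proof.
rewrite inE; apply: (iffP existsP) => -[eps].
  case/existsP=> sigma /existsP[phi pP]; exists eps, sigma, phi => e s v.
  by move/forallP: pP => /(_ e) /forallP /(_ s) /forallP /(_ v) /eqP.
case=> sigma [phi pP]; exists eps; apply/existsP; exists sigma.
apply/existsP; exists phi.
by apply/forallP => e; apply/forallP => s; apply/forallP => v; rewrite pP.
Qed.

Lemma wreath_group_set (p : nat) : group_set (wreath p).
Proof.
apply/group_setP; split=> [|pi1 pi2].
  apply/wreathP; exists 1%g, [ffun=> 1%g], [ffun=> 1%g] => e s v.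
  by rewrite !ffunE !perm1.
case/wreathP=> eps1 [sig1 [phi1 pi1E]] /wreathP[eps2 [sig2 [phi2 pi2E]]].
apply/wreathP; exists (eps1 * eps2)%g.
(* [sigma] and [phi] are indexed by image labels, so the data of [pi1] must be pulled back through
   [pi2]. *)
exists [ffun e => sig1 (eps2^-1%g e) * sig2 e]%g.
exists [ffun es => phi1 (eps2^-1%g es.1, (sig2 es.1)^-1%g es.2) * phi2 es]%g => e s v.
by rewrite [LHS]permM pi1E pi2E !ffunE /= !permM !permK.
Qed.

Lemma wreathV (p : nat) (pi : {perm idx p}) : pi \in wreath p -> pi^-1%g \in wreath p.
Proof. by rewrite -[wreath p]/(gval (Group (wreath_group_set p))) groupV. Qed.

Lemma part_actM (p : nat) (pi1 pi2 : {perm idx p}) (P : {set {set idx p}}) :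
  part_act (pi1 * pi2)%g P = part_act pi2 (part_act pi1 P).
Proof.
rewrite /part_act -imset_comp; apply: eq_imset => A /=.
by rewrite -imset_comp; apply: eq_imset => b; rewrite /= permM.
Qed.

Lemma part_act1 (p : nat) (P : {set {set idx p}}) : part_act 1%g P = P.
Proof.
rewrite /part_act -[RHS]imset_id; apply: eq_imset => A.
by rewrite -[RHS]imset_id; apply: eq_imset => b; rewrite perm1.
Qed.

Lemma isomorphicP (p : nat) (P Q : {set {set idx p}}) :
  reflect (exists2 pi, pi \in wreath p & Q = part_act pi P) (isomorphic P Q).
Proof.
apply: (iffP existsP) => [[pi /andP[piW /eqP->]]|[pi piW ->]]; exists pi => //.
by rewrite piW eqxx.
Qed.

Lemma isomorphic_refl (p : nat) (P : {set {set idx p}}) : isomorphic P P.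
Proof.
apply/isomorphicP; exists 1%g; last by rewrite part_act1.
by case/group_setP: (wreath_group_set p).
Qed.

Lemma isomorphic_sym (p : nat) (P Q : {set {set idx p}}) :
  isomorphic P Q -> isomorphic Q P.
Proof.
case/isomorphicP=> pi piW ->; apply/isomorphicP; exists (pi^-1)%g; first exact: wreathV.
by rewrite -part_actM mulgV part_act1.
Qed.

Lemma isomorphic_trans (p : nat) (P Q S : {set {set idx p}}) :
  isomorphic P Q -> isomorphic Q S -> isomorphic P S.
Proof.
case/isomorphicP=> pi1 pi1W -> /isomorphicP[pi2 pi2W ->].
apply/isomorphicP; exists (pi1 * pi2)%g; last by rewrite part_actM.
by case/group_setP: (wreath_group_set p) => _; apply.
Qed.

Lemma iso_class_eq (p : nat) (P Q : {set {set idx p}}) :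
  isomorphic P Q -> iso_class P = iso_class Q.
Proof.
move=> PQ; apply/finset.setP => S; rewrite !inE; congr andb.
by apply/idP/idP; apply: isomorphic_trans; [apply: isomorphic_sym|].
Qed.

(** * Invariance of [Con p] and of solution counts under isomorphism *)

Lemma ord2_sum_perm (phi : 'S_2) (F : 'I_2 -> nat) :
  (F (phi 0%R) + F (phi 1%R) = F 0%R + F 1%R)%N.
Proof.
have sumE G : (\sum_(i < 2) G i = G 0%R + G 1%R)%N.
  by rewrite !big_ord_recl big_ord0 addn0; congr (G _ + G _)%N; apply/val_inj.
by rewrite -!sumE -(sumE (F \o phi)) [RHS](reindex_inj (@perm_inj _ phi)).
Qed.

(** Points share a block of [P] exactly when their images share a block of the image partition. For
    balance, [phi] permutes the terms within a side and [sigma] at most swaps the two sides. *)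
Lemma assignments_part_act (p : nat) (pi : {perm idx p}) (P : {set {set idx p}})
    (tau : idx p -> nat) :
  pi \in wreath p -> assignments (part_act pi P) tau -> assignments P (tau \o pi).
Proof.
case/wreathP=> eps [sigma [phi piE]] [same bal]; split=> [b c|e] /=.
  rewrite same; split=> [[_ /imsetP[A AP ->]]|[A AP [bA cA]]].
    by rewrite !(mem_imset _ _ (@perm_inj _ pi)); exists A.
  exists [set pi x | x in A]%SET; first by apply/imsetP; exists A.
  by rewrite !(mem_imset _ _ (@perm_inj _ pi)).
pose S e' s := (tau (e', s, 0%R) + tau (e', s, 1%R))%N.
(* Balance makes the side sum independent of the side, so the sides picked by [sigma] are
   irrelevant. *)
have SE e' s s' : S e' s = S e' s'.
  have S01 (t : 'I_2) : S e' t = S e' 0%R.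
    case: t => [[|[|//]] t2]; first by congr (S e' _); apply/val_inj.
    by rewrite {2}/S bal; congr (S e' _); apply/val_inj.
  by rewrite S01 [RHS]S01.
rewrite !piE (ord2_sum_perm _ (fun v => tau (eps e, sigma (eps e) 0%R, v))).
by rewrite (ord2_sum_perm _ (fun v => tau (eps e, sigma (eps e) 1%R, v))); apply: SE.
Qed.

(** Injectivity of [pi] preserves cardinalities of classes, and [pi] carries block [e] onto block
    [eps e], so all parities transfer. An assignment transfers by composition with the inverse of
    [pi]. *)
Lemma Con_part_act (p : nat) (pi : {perm idx p}) (P : {set {set idx p}}) :
  pi \in wreath p -> P \in Con p -> part_act pi P \in Part p -> part_act pi P \in Con p.
Proof.
move=> piW; rewrite inE => /andP[_ /andP[/andP[evP /forallP blkP] /asboolP[tau tauP]]] Qp.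
rewrite inE Qp /=; apply/andP; split; last first.
  apply/asboolP; exists (tau \o (pi^-1)%g); apply: assignments_part_act (wreathV piW) _.
  by rewrite -part_actM mulgV part_act1.
apply/andP; split.
  apply/forall_inP => _ /imsetP[A AP ->]; rewrite card_imset; last exact: perm_inj.
  exact: (forall_inP evP).
case/wreathP: piW => eps [sigma [phi piE]].
have pi_block e : ([set pi b | b in idx_block e] = idx_block (eps e))%SET.
  apply/finset.setP => b; rewrite -(permKV pi b) (mem_imset _ _ (@perm_inj _ pi)).
  case: (_ b) => [[e' s] v]; rewrite piE !inE /=.
  by rewrite (inj_eq (@perm_inj _ eps)).
apply/forallP => e'; apply: contra (blkP (eps^-1%g e')).
rewrite !even_restr => /forall_inP ev; apply/forall_inP => A AP.
rewrite -(card_imset _ (@perm_inj _ pi)) imsetI => [|x y _ _]; last exact: perm_inj.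
by rewrite pi_block permKV; apply: ev; apply: imset_f.
Qed.

Lemma mem_Con_isomorphic (p : nat) (P Q : {set {set idx p}}) :
  isomorphic P Q -> P \in Con p -> Q \in Part p -> Q \in Con p.
Proof. by case/isomorphicP=> pi piW -> PC Qp; apply: Con_part_act. Qed.

(** Precomposition with [pi] is injective and gives one inequality; symmetry of isomorphism gives
    the other. *)
Lemma card_asgn_isomorphic (p l : nat) (P Q : {set {set idx p}}) :
  isomorphic P Q -> #|asgn P l| = #|asgn Q l|.
Proof.
have le (S T : {set {set idx p}}) : isomorphic S T -> (#|asgn T l| <= #|asgn S l|)%N.
  case/isomorphicP=> pi piW ->.
  pose h (tau : {ffun idx p -> 'I_l}) : {ffun idx p -> 'I_l} := [ffun b => tau (pi b)].
  have h_inj : injective h.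
    move=> s t st; apply/ffunP => b.
    have := congr1 (fun f : {ffun _ -> _} => f (pi^-1%g b)) st.
    by rewrite !ffunE permKV.
  rewrite -(card_imset _ h_inj); apply/subset_leq_card/fintype.subsetP => _ /imsetP[tau + ->].
  rewrite [_ \in asgn _ _]inE => /asboolP tauP; rewrite inE; apply/asboolP.
  have := assignments_part_act piW tauP.
  by congr assignments; apply/funext => b; rewrite ffunE.
by move=> PQ; apply/eqP; rewrite eqn_leq !le // isomorphic_sym.
Qed.

(** * Grouping by isomorphism classes *)

Lemma sum_iso_class (p l : nat) (P : {set {set idx p}}) :
  P \in Part p ->
  (\sum_(Q in iso_class P) #|asgn Q l| = #|iso_class P| * Sols (iso_class P) l)%N.
Proof.
(* The class contains [P], so the dummy value 0 in [Sols] is never reached. *)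
move=> Pp; rewrite /Sols; case: pickP => [Q|/(_ P)]; last first.
  by rewrite inE Pp isomorphic_refl.
rewrite inE => /andP[_ PQ]; rewrite card_assignments_lt -sum_nat_const.
apply: eq_bigr => S; rewrite inE => /andP[_ PS]; apply: card_asgn_isomorphic.
by apply: isomorphic_trans PQ; apply: isomorphic_sym.
Qed.

Theorem proposition4p13 (C : numClosedFieldType) (p l : nat) :
  central_moment p l (@ssac C) =
  \sum_(PP in Isom p) (#|PP| * Sols PP l)%:R.
Proof.
rewrite central_moment_good -natr_sum -sum_asgn_Con; congr _%:R.
rewrite (partition_big (@iso_class p) (mem (Isom p))) /=; last by move=> P; apply: imset_f.
apply: eq_bigr => _ /imsetP[P PC ->].
have Pp : P \in Part p by move: PC; rewrite inE => /andP[].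
rewrite -sum_iso_class //; apply: eq_bigl => Q.
(* The members of [Con p] with the same class as [P] fill that whole class, since [Con p] is closed
   under isomorphism. *)
rewrite [in RHS]inE; apply/andP/andP => [[QC /eqP PQ]|[Qp PQ]].
  have Qp : Q \in Part p by move: QC; rewrite inE => /andP[].
  have : Q \in iso_class P by rewrite -PQ inE Qp isomorphic_refl.
  by rewrite inE => /andP[].
by rewrite (mem_Con_isomorphic PQ) // (iso_class_eq PQ) eqxx.
Qed.
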